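(* Let $p$ be a prime and $m$ a positive integer with $\gcd(p,m)=1$. Assume that $m_0:=\gcd(p-1,m)\geq 3$ and let $d_0=(p-1)/m_0$. Then every integer $n\geq d_0+1$ lies in $W_p(m_0)$, and $W_p(m_0)\subseteq W_p(m)$.
   Context: For a prime $p$ and a positive integer $m$, $W_p(m)$ denotes the set of integers $n\geq 0$ for which there exist $\alpha_1,\dots,\alpha_n\in\overline{\mathbb{F}}_p$ with $\alpha_i^m=1$ for all $i$ (repetitions allowed) and $\alpha_1+\cdots+\alpha_n=0$. *)

(* Defs.v *)
From mathcomp Require Import all_boot all_order all_algebra all_field.

Set Implicit Arguments.
Unset Strict Implicit.
Unset Printing Implicit Defensive.

Import GRing.Theory.
Local Open Scope ring_scope.

(* The second component of [countable_algebraic_closure 'F_p] is an embedding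
   of 'F_p whose range the whole field is integral (i.e. algebraic) over.
   For p not prime, 'F_p is the prime field of order [pdiv p] (or 'F_2), so
   this is the intended field only under the hypothesis [prime p]. *)
Definition Fpbar (p : nat) : countClosedFieldType :=
  tag (countable_algebraic_closure 'F_p).

Definition W (p m n : nat) : Prop :=
  exists a : 'I_n -> Fpbar p,
    (forall i, a i ^+ m = 1) /\ \sum_i a i = 0.

(* Main.v *)
(** Let [z] be a primitive [m0]-th root of unity in 'F_p and let [S k] be the set
of sums of exactly [k] powers of [z].  It is stable under multiplication by [z],
so the number of its nonzero elements is a multiple of [m0], and since [z ^+ 2 != 1]
the elements of [S k] have zero sum and zero sum of squares.  If [S k.+1], which contains
[S k + 1], had no more nonzero elements than [S k], it would miss at most one
point [x] outside [S k + 1], and comparing sums and sums of squares gives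
[x = - #|S k|] and [#|S k| (#|S k| + 1) = 0] in 'F_p, hence [S k.+1] is everything.
Thus [S k] contains all nonzero elements, in particular [-1], once [k >= d0]. *)
Require Import Defs.
From mathcomp Require Import all_boot all_order all_algebra all_field.
From mathcomp Require Import cyclic ring zify.

Set Implicit Arguments.
Unset Strict Implicit.
Unset Printing Implicit Defensive.

Import GRing.Theory.
Local Open Scope ring_scope.

Definition mul_stable (F : finFieldType) (z : F) (A : {set F}) : Prop :=
  forall x, x \in A -> z * x \in A.

Lemma mul_stable_exp (F : finFieldType) (z : F) (A : {set F}) (i : nat) :
  mul_stable z A -> mul_stable (z ^+ i) A.
Proof.
move=> zA x xA; elim: i => [|i IHi]; first by rewrite expr0 mul1r.
by rewrite exprS -mulrA; apply: zA.
Qed.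

Lemma mul_stableD1 (F : finFieldType) (z : F) (A : {set F}) :
  z != 0 -> mul_stable z A -> mul_stable z (A :\ 0).
Proof.
move=> z0 zA x; rewrite !inE => /andP[x0 /zA ->].
by rewrite mulf_neq0.
Qed.

(** The fibres of [x ^+ n] on [A] are exactly the orbits of multiplication by [z], and each orbit of
    a nonzero point has [n] elements. *)
Lemma prim_root_dvdn_card (F : finFieldType) (n : nat) (z : F) (A : {set F}) :
  n.-primitive_root z -> 0 \notin A -> mul_stable z A -> (n %| #|A|)%N.
Proof.
move=> zprim A0 zA; rewrite -sum1_card (partition_big_imset (fun x => x ^+ n)) /=.
apply: dvdn_sum => _ /imsetP[x xA ->].
have x0 : x != 0 by apply: contraNneq A0 => <-.
suff -> : (\sum_(i in A | i ^+ n == x ^+ n) 1 = n)%N by [].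
rewrite sum1dep_card -[RHS](card_ord n).
rewrite -[RHS](@card_imset _ _ (fun i : 'I_n => z ^+ i * x)); last first.
  move=> i j /(mulIf x0) /eqP; rewrite (eq_prim_root_expr zprim).
  by rewrite !modn_small // => /eqP/val_inj.
(* Fibre equals orbit: [y ^+ n = x ^+ n] makes [y / x] an [n]-th root of unity, hence a power of
   [z]. *)
apply: eq_card => y; rewrite !inE; apply/andP/imsetP => [[yA /eqP yx]|[i _ ->]].
  have: (y / x) ^+ n = 1 by rewrite expr_div_n yx divff // expf_neq0.
  move=> /(prim_rootP zprim) [i yxE]; exists i => //.
  by rewrite -yxE divfK.
split; first exact: mul_stable_exp.
by rewrite exprMn exprAC (prim_expr_order zprim) expr1n mul1r.
Qed.

(** Multiplication by [z] permutes the finite set [A], so the sum [s] satisfies [s = z ^+ j * s]. *)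
Lemma mul_stable_power_sum (F : finFieldType) (z : F) (A : {set F}) (j : nat) :
  z != 0 -> z ^+ j != 1 -> mul_stable z A -> \sum_(x in A) x ^+ j = 0.
Proof.
move=> z0 zj zA; set s := \sum_(x in A) _.
have zAE : [set z * x | x in A] = A.
  apply/eqP; rewrite eqEcard card_imset ?leqnn ?andbT; last exact: mulfI.
  by apply/subsetP => _ /imsetP[x xA ->]; exact: zA.
have: s = z ^+ j * s.
  rewrite {1}/s -{1}zAE big_imset /=; last by move=> x y _ _; exact: mulfI.
  by rewrite mulr_sumr; apply: eq_bigr => x _; rewrite exprMn.
move/eqP; rewrite -subr_eq0 -{1}[s]mul1r -mulrBl mulf_eq0 subr_eq0 eq_sym.
by rewrite (negbTE zj) => /eqP.
Qed.

Lemma mul_stable_translate_setT (p : nat) (z : 'F_p) (A B : {set 'F_p}) :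
  prime p -> z != 0 -> z ^+ 2 != 1 -> mul_stable z A -> mul_stable z B ->
  A != set0 -> (forall x, x \in A -> x + 1 \in B) ->
  (#|B :\ 0%R| <= #|A :\ 0%R|)%N -> B = setT.
Proof.
move=> p_prime z0 z2 zA zB A0 AB leBA.
have z1 : z ^+ 1 != 1 by apply: contraNneq z2 => z1; rewrite -[z]expr1 z1 expr1n.
have sA1 := mul_stable_power_sum z0 z1 zA.
have sA2 := mul_stable_power_sum z0 z2 zA.
have sB1 := mul_stable_power_sum z0 z1 zB.
have sB2 := mul_stable_power_sum z0 z2 zB.
have cardF : #|{: 'F_p}| = p by rewrite card_Fp.
have natF0 n : n%:R = 0 :> 'F_p -> (p %| n)%N.
  by move/eqP; rewrite -(dvdn_pcharf (pchar_Fp p_prime)).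
pose C := [set x + 1 | x in A].
have injC : injective (fun x : 'F_p => x + 1) by move=> x y /addIr.
have cardC : #|C| = #|A| by rewrite card_imset.
have CB : C \subset B by apply/subsetP => _ /imsetP[x xA ->]; exact: AB.
have sC1 : \sum_(x in C) x ^+ 1 = #|A|%:R.
  rewrite big_imset /=; last by move=> x y _ _; exact: injC.
  rewrite -[LHS]/(\sum_(x in A) (x ^+ 1 + 1)).
  by rewrite big_split /= sA1 add0r sumr_const.
have sC2 : \sum_(x in C) x ^+ 2 = #|A|%:R.
  rewrite big_imset /=; last by move=> x y _ _; exact: injC.
  (* The square is expanded into power sums over [A] that are already known to vanish, plus a
     constant. *)
  transitivity (\sum_(x in A) (x ^+ 2 + (x ^+ 1 + x ^+ 1) + 1)).
    by apply: eq_bigr => x _; ring.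
  by rewrite !big_split /= sA1 sA2 !add0r sumr_const.
have le_p (D : {set 'F_p}) : (#|D| <= p)%N by apply: leq_trans (max_card _) _; rewrite cardF.
have gt0A : (0 < #|A|)%N by rewrite card_gt0.
have := le_p A; have := le_p B => leB leA.
have leAB : (#|A| <= #|B|)%N by rewrite -cardC subset_leq_card.
have cA : #|A| = ((0%R \in A) + #|A :\ 0%R|)%N := cardsD1 0 A.
have cB : #|B| = ((0%R \in B) + #|B :\ 0%R|)%N := cardsD1 0 B.
suff leB' : (p <= #|B|)%N.
  by apply/eqP; rewrite eqEcard subsetT cardsT cardF.
have cD : #|B :\: C| = (#|B| - #|A|)%N.
  by rewrite cardsD (setIidPr CB) cardC.
have sumB j : \sum_(x in B) x ^+ j = \sum_(x in C) x ^+ j + \sum_(x in B :\: C) x ^+ j.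
  by rewrite (big_setID C) /= (setIidPr CB).
(* If [B] is no larger than [A], then [B = C], and the first power sums give that [p] divides
   [#|A|], which is positive. *)
have [BA|ltAB] := leqP #|B| #|A|.
  have D0 : B :\: C = set0 by apply/eqP; rewrite -cards_eq0 cD; lia.
  have := sumB 1%N; rewrite D0 big_set0 addr0 sB1 sC1 => /esym/natF0 /dvdn_leq.
  lia.
(* Only the element 0 is left out of the count in [leBA], so [B] exceeds [A] by exactly one
   element. *)
have /cards1P[x Dx] : #|B :\: C| == 1%N.
  by rewrite cD; move: leBA cA cB ltAB; case: (0 \in A); case: (0 \in B) => /=; lia.
have := sumB 1%N; have := sumB 2; rewrite Dx !big_set1 sB1 sB2 sC1 sC2 expr1.
move=> e2 e1; have xE : x = - #|A|%:R by apply/eqP; rewrite -addr_eq0 addrC -e1.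
have : (#|A| * #|A|.+1)%:R = 0 :> 'F_p.
  by rewrite natrM -natr1 e2 xE; ring.
(* Whether [p] divides [#|A|] or [#|A|.+1], it is at most [#|B| = #|A|.+1]. *)
move/natF0; rewrite Euclid_dvdM // => /orP[] /dvdn_leq; lia.
Qed.

(** Exponents range over the finite type ['I_m] so that the image is a finite set; when [z] is a
    primitive [m]-th root of unity this loses no power. *)
Fixpoint root_sums (F : finFieldType) (m : nat) (z : F) (k : nat) : {set F} :=
  if k is k'.+1 then [set x + z ^+ i | x : F in root_sums m z k', i : 'I_m]
  else [set 0].

Lemma root_sumsP (F : finFieldType) (m : nat) (z : F) (k : nat) (x : F) :
  x \in root_sums m z k -> exists a : 'I_k -> nat, x = \sum_i z ^+ a i.
Proof.
elim: k x => [|k IHk] x /=.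
  by rewrite inE => /eqP ->; exists (fun=> 0%N); rewrite big_ord0.
case/imset2P => y i /IHk[a ->] _ ->.
(* The new exponent [i] goes to the last index; the earlier indices keep the exponents given by
   [a]. *)
exists (fun j => if unlift ord_max j is Some j' then a j' else i : nat).
rewrite big_ord_recr /= unlift_none; congr (_ + _); apply: eq_bigr => j _.
by rewrite (_ : widen_ord _ j = lift ord_max j) ?liftK //; apply: val_inj; rewrite /= /bump leqNgt ltn_ord.
Qed.

Lemma root_sums_add (F : finFieldType) (m : nat) (z : F) (k i : nat) (x : F) :
  m.-primitive_root z -> x \in root_sums m z k -> x + z ^+ i \in root_sums m z k.+1.
Proof.
move=> zprim xS; rewrite -(prim_expr_mod zprim).
have im : (i %% m < m)%N by rewrite ltn_mod (prim_order_gt0 zprim).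
by apply/imset2P; exists x (Ordinal im).
Qed.

Lemma root_sums_stable (F : finFieldType) (m : nat) (z : F) (k : nat) :
  m.-primitive_root z -> mul_stable z (root_sums m z k).
Proof.
move=> zprim; elim: k => [|k IHk] x.
  by rewrite !inE => /eqP ->; rewrite mulr0.
case/imset2P => y i yS _ ->; rewrite mulrDr -exprS.
exact: root_sums_add (IHk _ yS).
Qed.

Lemma root_sums_neq0 (F : finFieldType) (m : nat) (z : F) (k : nat) :
  m.-primitive_root z -> root_sums m z k != set0.
Proof.
move=> zprim; elim: k => [|k /set0Pn[x xS]]; apply/set0Pn.
  by exists 0; rewrite inE.
by exists (x + z ^+ 0); apply: root_sums_add.
Qed.

Lemma card_root_sums (p m : nat) (z : 'F_p) (k : nat) :
  prime p -> (2 < m)%N -> m.-primitive_root z ->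
  (minn (k * m) p.-1 <= #|root_sums m z k :\ 0%R|)%N.
Proof.
move=> p_prime m_gt2 zprim.
have z0 : z != 0 by rewrite (prim_root_eq0 zprim); lia.
have z2 : z ^+ 2 != 1.
  by rewrite -(prim_order_dvd zprim); apply/negP => /dvdn_leq; lia.
have stable := root_sums_stable zprim.
have dvd j : (m %| #|root_sums m z j :\ 0%R|)%N.
  apply: (prim_root_dvdn_card zprim); first by rewrite !inE eqxx.
  exact: mul_stableD1.
elim: k => [|k IHk]; first by rewrite mul0n min0n.
have [le|lt] := leqP #|root_sums m z k.+1 :\ 0%R| #|root_sums m z k :\ 0%R|.
  have -> : root_sums m z k.+1 = setT.
    apply: (mul_stable_translate_setT p_prime z0 z2 (stable k) (stable _)) le.
      exact: root_sums_neq0.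
    by move=> x; rewrite -(expr0 z); apply: root_sums_add.
  by rewrite setTD cardsC1 card_Fp // geq_minr.
(* Both counts are multiples of [m], so a strict increase is an increase by at least [m]. *)
case/dvdnP: (dvd k) IHk lt => a ->; case/dvdnP: (dvd k.+1) => b ->.
rewrite ltn_mul2r => IHk /andP[_ ab].
have : (a.+1 * m <= b * m)%N by rewrite leq_mul2r ab orbT.
rewrite !mulSn; lia.
Qed.

(** A suitable power of a generator of the multiplicative group of ['F_p] has order [m]. *)
Lemma Fp_prim_root (p m : nat) :
  prime p -> (m %| p.-1)%N -> exists z : 'F_p, m.-primitive_root z.
Proof.
move=> p_prime m_dvd.
have p1_gt0 : (0 < p.-1)%N by have := prime_gt1 p_prime; lia.
have /hasP[z _ zprim] : has p.-1.-primitive_root (enum [pred x : 'F_p | x != 0]).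
  apply: has_prim_root => //; last 2 first.
  - exact: enum_uniq.
  - by rewrite -cardE cardC1 card_Fp.
  apply/allP => x; rewrite mem_enum inE => x0; rewrite unity_rootE; apply/eqP.
  (* Fermat's identity [x ^+ p = x], with one factor [x] cancelled. *)
  apply: (mulfI x0); rewrite -exprS prednK ?prime_gt0 // mulr1.
  by have := expf_card x; rewrite card_Fp.
by exists (z ^+ (p.-1 %/ m)); apply: dvdn_prim_root.
Qed.

Lemma root_sums_W (p m n : nat) (z : 'F_p) :
  m.-primitive_root z -> 0 \in root_sums m z n -> W p m n.
Proof.
move=> zprim /root_sumsP[a a0].
have [f _] := tagged (countable_algebraic_closure 'F_p).
exists (fun i => f (z ^+ a i)); split=> [i|].
  by rewrite -rmorphXn exprAC (prim_expr_order zprim) expr1n rmorph1.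
by rewrite -rmorph_sum -a0 rmorph0.
Qed.

Lemma W_dvdn (p m m' n : nat) : (m %| m')%N -> W p m n -> W p m' n.
Proof.
case/dvdnP => c -> [a [am a0]]; exists a; split=> // i.
by rewrite mulnC exprM am expr1n.
Qed.

Local Close Scope ring_scope.

Theorem theorem3p1 (p m : nat) (p_prime : prime p) (m_gt0 : 0 < m)
    (p_coprime_m : gcdn p m = 1)
    (m0 := gcdn (p - 1) m) (m0_ge3 : 3 <= m0)
    (d0 := (p - 1) %/ m0) :
  (forall n : nat, d0 + 1 <= n -> W p m0 n) /\
  (forall n : nat, W p m0 n -> W p m n).
Proof.
split=> n; last by apply: W_dvdn; apply: dvdn_gcdr.
have m0_dvd : m0 %| p.-1 by rewrite -subn1 dvdn_gcdl.
have [z zprim] := Fp_prim_root p_prime m0_dvd.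
(* One summand is set aside: the other [n] will sum to [-1], and the last is [z ^+ 0 = 1]. *)
case: n => [|n]; rewrite addn1 // ltnS => d0n.
apply: (root_sums_W zprim).
have : p.-1 <= #|root_sums m0 z n :\ 0%R|.
  apply: leq_trans (card_root_sums n p_prime m0_ge3 zprim).
  (* Since [d0 * m0 = p.-1] and [d0 <= n], the minimum in the bound is [p.-1]. *)
  rewrite leq_min leqnn andbT -{1}(divnK m0_dvd) leq_mul2r -subn1.
  by rewrite d0n orbT.
move=> le_card; have : root_sums m0 z n :\ 0%R = [set~ 0%R].
  apply/eqP; rewrite eqEcard cardsC1 card_Fp // le_card andbT.
  by apply/subsetP => x; rewrite !inE => /andP[].
move/setP/(_ (-1)%R); rewrite !inE oppr_eq0 oner_eq0 /= => N1S.
by have := root_sums_add 0 zprim N1S; rewrite expr0 addNr.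
Qed.
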